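(* Let $X$ be a B-convex Banach space (i.e. one with nontrivial infratype) and let $F:[0,1]\to 2^{X}\setminus\{\varnothing\}$ be a bounded multifunction. Then every element of $I(F)$ is a convex subset of $X$.
   Context: A Banach space $X$ has infratype $p$ with constant $C$ if $\min_{a_k=\pm1}\left\|\sum_{k=1}^n a_kx_k\right\|\le C\left(\sum_{k=1}^n\|x_k\|^p\right)^{1/p}$ for every finite collection $\{x_k\}_{k=1}^n\subset X$. It has nontrivial infratype, equivalently is called B-convex, if it has infratype $p$ for some $p>1$ with some constant $C$. For subsets $A,B$ of a Banach space $X$ and $\lambda\in\mathbb{R}$: $A+B=\{a+b: a\in A, b\in B\}$, $\lambda A=\{\lambda a: a\in A\}$. A tagged partition $(\Gamma,T)$ of $[0,1]$ consists of a partition $\Gamma=\{\Delta_i\}_{i=1}^n$ of $[0,1]$ into (non-overlapping closed) segments $\Delta_i=[a_i,b_i]$ and tags $T=\{\xi_i\}_{i=1}^n$, $\xi_i\in\Delta_i$. Write $|\Delta_i|=b_i-a_i$ and $d(\Gamma)=\max_i|\Delta_i|$. A multifunction is a map $F:[0,1]\to 2^X\setminus\{\varnothing\}$. It is bounded if $M(F)=\sup\{\|a\|: a\in F(t), t\in[0,1]\}<\infty$. Its Riemann sums are $S(F,\Gamma,T)=\sum_{i=1}^n|\Delta_i|F(\xi_i)$ (Minkowski sum). The Hausdorff distance between non-empty sets is $d_H(A,B)=\max\{\sup_{a\in A}d(a,B),\sup_{b\in B}d(b,A)\}$. For bounded $F$, $I(F)$ is the collection of all non-empty closed subsets $A\subset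 X$ for which there is a sequence of tagged partitions $(\Gamma_k,T_k)$ with $d(\Gamma_k)\to0$ and $d_H(S(F,\Gamma_k,T_k),A)\to0$ as $k\to\infty$. *)

(* Defs.v *)
From HB Require Import structures.
From mathcomp Require Import all_boot all_order all_algebra.
From mathcomp Require Import all_classical all_reals all_analysis.

Set Implicit Arguments.
Unset Strict Implicit.
Unset Printing Implicit Defensive.

Import Order.TTheory GRing.Theory Num.Theory.
Import numFieldNormedType.Exports.

Local Open Scope classical_set_scope.
Local Open Scope ring_scope.

Definition signed_sum (R : realType) (X : normedModType R) (n : nat)
    (x : 'I_n -> X) (a : {ffun 'I_n -> bool}) : X :=
  \sum_(k < n) ((-1) ^+ a k : R) *: x k.

(* [Num.min] has no neutral element: the iterated minimum starts from the value
   at the choice a_k = +1 for all k, which is one of the minimized values. *)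
Definition min_signed_norm (R : realType) (X : normedModType R) (n : nat)
    (x : 'I_n -> X) : R :=
  \big[Num.min/`|signed_sum x [ffun=> false]|]_(a : {ffun 'I_n -> bool})
    `|signed_sum x a|.

Definition infratype (R : realType) (X : normedModType R) (p C : R) : Prop :=
  forall (n : nat) (x : 'I_n -> X),
    min_signed_norm x <= C * (\sum_(k < n) `|x k| `^ p) `^ p^-1.

Definition B_convex (R : realType) (X : normedModType R) : Prop :=
  exists p C : R, 1 < p /\ infratype X p C.

Definition set_add (R : realType) (X : normedModType R) (A B : set X) : set X :=
  [set a + b | a in A & b in B].

Definition set_scale (R : realType) (X : normedModType R) (l : R) (A : set X) :
    set X :=
  [set l *: a | a in A].

(* The segments are not assumed to be listed in increasing order. *)
Record tagged_partition (R : realType) := TaggedPartition {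
  tp_size : nat;
  tp_left : 'I_tp_size -> R;
  tp_right : 'I_tp_size -> R;
  tp_tag : 'I_tp_size -> R;
  tp_lt : forall i, tp_left i < tp_right i;
  tp_cover :
    \bigcup_(i in [set: 'I_tp_size]) `[tp_left i, tp_right i]%classic
    = `[0, 1]%classic;
  tp_nonoverlap :
    trivIset [set: 'I_tp_size] (fun i => `]tp_left i, tp_right i[%classic);
  tp_tagP : forall i, tp_left i <= tp_tag i <= tp_right i
}.

Definition tp_length (R : realType) (P : tagged_partition R)
    (i : 'I_(tp_size P)) : R :=
  tp_right i - tp_left i.

Definition tp_mesh (R : realType) (P : tagged_partition R) : R :=
  \big[Num.max/0]_(i < tp_size P) tp_length i.

(* A multifunction on [0, 1] is represented by F : R -> set X; only its values
   on [0, 1] matter below, since all tags lie in [0, 1]. *)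
Definition multifunction01 (R : realType) (X : normedModType R)
    (F : R -> set X) : Prop :=
  forall t, `[0, 1]%classic t -> F t !=set0.

Definition mf_sup_norm (R : realType) (X : normedModType R)
    (F : R -> set X) : \bar R :=
  ereal_sup [set `|a|%:E | a in \bigcup_(t in `[0, 1]%classic) F t].

Definition mf_bounded (R : realType) (X : normedModType R)
    (F : R -> set X) : Prop :=
  (mf_sup_norm F < +oo)%E.

Definition riemann_sum (R : realType) (X : normedModType R) (F : R -> set X)
    (P : tagged_partition R) : set X :=
  \big[@set_add R X/[set 0]]_(i < tp_size P)
    set_scale (tp_length i) (F (tp_tag i)).

(* Extended-real valued: the distance may be infinite for unbounded sets. *)
Definition hausdorff_dist (R : realType) (X : normedModType R)
    (A B : set X) : \bar R :=
  maxe (ereal_sup [set edist_inf B a | a in A])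
       (ereal_sup [set edist_inf A b | b in B]).

Definition riemann_limits (R : realType) (X : normedModType R)
    (F : R -> set X) : set (set X) :=
  [set A | [/\ A !=set0, closed A &
     exists P : nat -> tagged_partition R,
       tp_mesh (P k) @[k --> \oo] --> (0 : R) /\
       hausdorff_dist (riemann_sum F (P k)) A @[k --> \oo] --> (0 : \bar R)%E]].

(* Main.v *)
(* For a closed A it suffices to find approximate midpoints.  Two points
   u = \sum_i |Delta_i| x_i and v = \sum_i |Delta_i| y_i of a Riemann sum, with
   x_i, y_i in F(xi_i), admit the points
     z = (u + v) / 2 + (1 / 2) \sum_i a_i |Delta_i| (x_i - y_i),  a_i = +-1,
   obtained by keeping x_i or y_i according to a_i.  For a good choice of signs
   infratype p bounds |z - (u + v) / 2| by
   C M (\sum_i |Delta_i|^p)^(1/p) <= C M d(Gamma)^((p-1)/p), since the lengths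
   sum to at most 1, and this tends to 0 because p > 1. *)
Require Import Defs.
From HB Require Import structures.
From mathcomp Require Import all_boot all_order all_algebra.
From mathcomp Require Import all_classical all_reals all_analysis.
From mathcomp Require Import ring lra.

Set Implicit Arguments.
Unset Strict Implicit.
Unset Printing Implicit Defensive.

Import Order.TTheory GRing.Theory Num.Theory.
Import numFieldNormedType.Exports.

Local Open Scope classical_set_scope.
Local Open Scope ring_scope.

Lemma big_set_addP (R : realType) (X : normedModType R) (n : nat)
    (G : 'I_n -> set X) (z : X) :
  (\big[@set_add R X/[set 0]]_(i < n) G i) z <->
  exists2 x : 'I_n -> X, (forall i, G i (x i)) & z = \sum_(i < n) x i.
Proof.
elim: n G z => [|n IHn] G z.
  rewrite big_ord0; split=> [->|[x _ ->]]; last by rewrite big_ord0.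
  by exists (fun=> 0) => [[]//|]; rewrite big_ord0.
rewrite big_ord_recl; split=> [[a Ga [b /IHn[x Gx ->] <-]]|[x Gx ->]].
  exists (fun i => if unlift ord0 i is Some j then x j else a) => [i|].
    by case: unliftP => [j ->|->].
  rewrite big_ord_recl unlift_none; congr (_ + _).
  by apply: eq_bigr => i _; rewrite liftK.
rewrite big_ord_recl; exists (x ord0) => //.
by exists (\sum_(i < n) x (lift ord0 i)) => //; apply/IHn; exists (x \o lift ord0).
Qed.

(** Selections from the values at the tags replace iterated Minkowski sums, so that points can later
    be exchanged tag by tag. *)
Lemma riemann_sumP (R : realType) (X : normedModType R) (F : R -> set X)
    (P : tagged_partition R) (z : X) :
  riemann_sum F P z <->
  exists2 x : 'I_(tp_size P) -> X, (forall i, F (tp_tag i) (x i)) &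
    z = \sum_i tp_length i *: x i.
Proof.
rewrite /riemann_sum big_set_addP; split=> [[y Fy ->]|[x Fx ->]]; last first.
  by exists (fun i => tp_length i *: x i) => // i; exists (x i).
have /choice[x xP] i : exists a, F (tp_tag i) a /\ tp_length i *: a = y i.
  by have [a] := Fy i; exists a.
by exists x => [i|]; [case: (xP i)|apply: eq_bigr => i _; case: (xP i)].
Qed.

Lemma tp_length_gt0 (R : realType) (P : tagged_partition R)
    (i : 'I_(tp_size P)) : 0 < tp_length i.
Proof. by rewrite subr_gt0 tp_lt. Qed.

Lemma tp_length_le_mesh (R : realType) (P : tagged_partition R)
    (i : 'I_(tp_size P)) : tp_length i <= tp_mesh P.
Proof. exact: le_bigmax. Qed.

Lemma tp_itv_sub (R : realType) (P : tagged_partition R)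
    (i : 'I_(tp_size P)) :
  `[tp_left i, tp_right i]%classic `<=` `[0, 1]%classic.
Proof. by rewrite -(tp_cover P) => x Px; exists i. Qed.

Lemma tp_tag01 (R : realType) (P : tagged_partition R) (i : 'I_(tp_size P)) :
  `[0, 1]%classic (tp_tag i).
Proof. by apply: (@tp_itv_sub _ _ i); rewrite /= in_itv/= tp_tagP. Qed.

(** The segments come in no particular order, so nothing telescopes. Instead, the open segments are
    disjoint measurable subsets of the unit interval, and Lebesgue measure is additive and
    monotone. *)
Lemma sum_tp_length_le1 (R : realType) (P : tagged_partition R) :
  \sum_i @tp_length R P i <= 1.
Proof.
pose mu := @lebesgue_measure R.
pose J (i : 'I_(tp_size P)) : set R := `]tp_left i, tp_right i[%classic.
have mJ i : measurable (J i) by exact: measurable_itv.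
have muJ i : mu (J i) = (tp_length i)%:E.
  by rewrite /mu lebesgue_measure_itv /= lte_fin tp_lt -EFinD.
have mu01 : mu `[0, 1]%classic = 1%:E.
  by rewrite /mu lebesgue_measure_itv /= lte01 oppr0 adde0.
rewrite -lee_fin -mu01 -sumEFin.
under eq_bigr do rewrite -muJ.
rewrite -(@measure_bigsetU_ord _ _ _ mu _ xpredT J)//; last exact: tp_nonoverlap.
apply: le_measure; rewrite ?inE.
- by apply: bigsetU_measurable => i _; exact: mJ.
- exact: measurable_itv.
- rewrite -bigcup_seq => x [i _ Jx].
  by apply: (@tp_itv_sub _ _ i); apply: subset_itv_oo_cc.
Qed.

Lemma closed_approx (R : realType) (X : normedModType R) (A : set X) (x : X) :
  closed A -> (forall e, 0 < e -> exists2 a, A a & `|x - a| < e) -> A x.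
Proof.
move=> clA Ax; apply: clA => U /nbhs_ballP[e /= e0 eU].
have [a Aa xa] := Ax e e0; exists a; split=> //.
by apply: eU; rewrite -ball_normE.
Qed.

(** Bisection: for [t] in the left half, take the midpoint of [0] and an approximation of [2 * t];
    in the right half, the midpoint of [1] and an approximation of [2 * t - 1]. Each step halves the
    error. *)
Lemma midpoint_dyadic_approx (R : realType) (T : set R) (n : nat) (t : R) :
  T 0 -> T 1 -> (forall s u, T s -> T u -> T (2^-1 * (s + u))) ->
  0 <= t <= 1 -> exists2 s, T s & `|t - s| <= 2^-1 ^+ n.
Proof.
move=> T0 T1 Tm; elim: n t => [|n IHn] t /andP[t0 t1].
  by exists 0 => //; rewrite subr0 ger0_norm// expr0.
have [t2|t2] := leP t 2^-1.
  have [|s Ts ts] := IHn (2 * t); first by lra.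
  exists (2^-1 * (0 + s)); first exact: Tm.
  rewrite (_ : t - _ = 2^-1 * (2 * t - s)); last by field.
  by rewrite normrM ger0_norm ?invr_ge0// exprS ler_pM2l// invr_gt0.
have [|s Ts ts] := IHn (2 * t - 1); first by lra.
exists (2^-1 * (1 + s)); first exact: Tm.
rewrite (_ : t - _ = 2^-1 * (2 * t - 1 - s)); last by field.
by rewrite normrM ger0_norm ?invr_ge0// exprS ler_pM2l// invr_gt0.
Qed.

Lemma closed_midpoint_convex (R : realType) (X : normedModType R) (A : set X) :
  closed A -> (forall a b, A a -> A b -> A (2^-1 *: (a + b))) ->
  convex_set (A : set (convex_lmodType X)).
Proof.
move=> clA mA a b l /[!inE] Aa Ab.
set t : R := l%:num.
have t01 : 0 <= t <= 1 by rewrite /t ge0 le1.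
rewrite (_ : conv l a b = t *: (a : X) + (1 - t) *: (b : X))//.
(* The parameters whose point on the segment lies in [A] contain both ends and are stable under
   midpoints, hence are dense in the unit interval. *)
pose T := [set s | A (s *: (a : X) + (1 - s) *: (b : X))].
have T0 : T 0 by rewrite /T/= scale0r add0r subr0 scale1r.
have T1 : T 1 by rewrite /T/= scale1r subrr scale0r addr0.
have Tm s u : T s -> T u -> T (2^-1 * (s + u)).
  move=> Ts Tu; rewrite /T/=; have := mA _ _ Ts Tu.
  rewrite addrACA -!scalerDl scalerDr !scalerA.
  by rewrite (_ : 2^-1 * (1 - s + (1 - u)) = 1 - 2^-1 * (s + u))//; field.
apply: closed_approx clA _ => e e0.
(* Adding [1] keeps the divisor positive when [a] and [b] coincide. *)
have d0 : 0 < e / (`|(a : X) - b| + 1) by rewrite divr_gt0// ltr_wpDl.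
have [n _ /(_ n (leqnn n)) hn] := near_infty_natSinv_expn_lt (PosNum d0).
have [s Ts ts] := midpoint_dyadic_approx n T0 T1 Tm t01.
exists (s *: (a : X) + (1 - s) *: (b : X)) => //.
rewrite (_ : _ - _ = (t - s) *: ((a : X) - b)); last first.
  rewrite opprD addrACA -!scalerBl scalerBr -scaleNr; congr (_ + _ *: _).
  by ring.
rewrite normrZ (@le_lt_trans _ _ (2^-1 ^+ n * (`|(a : X) - b| + 1)))//.
  by rewrite ler_pM// lerDl.
by rewrite -ltr_pdivlMr ?ltr_wpDl// exprVn -div1r.
Qed.

(** A finite minimum is attained, either at its starting value (all signs [+1]) or at some listed
    choice of signs. *)
Lemma infratype_signs (R : realType) (X : normedModType R) (p C : R) (n : nat)
    (x : 'I_n -> X) : infratype X p C ->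
  exists a, `|signed_sum x a| <= C * (\sum_(k < n) `|x k| `^ p) `^ p^-1.
Proof. by move=> /(_ n x) /bigmin_leP[|[a _]]; [exists [ffun=> false]|exists a]. Qed.

(** Each length [l] satisfies [l ^ p = l * l ^ (p - 1) <= l * d ^ (p - 1)], and the lengths sum to
    at most [1]. *)
Lemma sum_powR_length_le (R : realType) (P : tagged_partition R) (p d : R) :
  1 < p -> tp_mesh P <= d -> \sum_i @tp_length R P i `^ p <= d `^ (p - 1).
Proof.
move=> p1 Pd; have p0 : 0 < p by lra.
apply: (@le_trans _ _ (\sum_i @tp_length R P i * d `^ (p - 1))); last first.
  by rewrite -mulr_suml ler_piMl ?powR_ge0// sum_tp_length_le1.
apply: ler_sum => i _; have l0 := tp_length_gt0 i.
have ld := le_trans (tp_length_le_mesh i) Pd.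
rewrite -mulr_powRB1 ?(ltW l0)// ler_pM2l//.
have p10 : 0 <= p - 1 by lra.
by rewrite ge0_ler_powR// ?nnegrE ?(ltW l0)// (le_trans (ltW l0) ld).
Qed.

(** The threshold [d] is uniform in the partition, its number of segments and the vectors [w]. It
    solves [C' * K * d ^ ((p - 1) / p) = e]. *)
Lemma B_convex_small_signs (R : realType) (X : normedModType R) (K e : R) :
  B_convex X -> 0 < K -> 0 < e ->
  exists2 d : R, 0 < d & forall P : tagged_partition R, tp_mesh P < d ->
    forall w : 'I_(tp_size P) -> X, (forall i, `|w i| <= K) ->
    exists a, `|signed_sum (fun i => tp_length i *: w i) a| <= e.
Proof.
move=> [p [C [p1 ipC]]] K0 e0; have p0 : 0 < p by lra.
(* The infratype constant has no prescribed sign, and [r] divides by it; enlarging it to at least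
   [1] is harmless. *)
pose C' := Num.max C 1; have C'0 : 0 < C' by rewrite lt_max ltr01 orbT.
pose r := e / (C' * K); have r0 : 0 < r by rewrite divr_gt0// mulr_gt0.
pose d := r `^ (p / (p - 1)).
have dp : d `^ (p - 1) = r `^ p.
  by rewrite /d -powRrM mulfVK//; lra.
exists d; first by rewrite powR_gt0.
move=> P Pd w wK; have [a ha] := infratype_signs (fun i => tp_length i *: w i) ipC.
exists a; apply: le_trans ha _.
set s := \sum_(k < _) _.
have s0 : 0 <= s by apply: sumr_ge0 => i _; exact: powR_ge0.
have sle : s <= (r * K) `^ p.
  rewrite powRM ?(ltW r0) ?(ltW K0)// -dp.
  apply: (@le_trans _ _ ((\sum_i @tp_length R P i `^ p) * K `^ p)); last first.
    by rewrite ler_wpM2r ?powR_ge0// sum_powR_length_le// ltW.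
  rewrite mulr_suml; apply: ler_sum => i _; have l0 := ltW (tp_length_gt0 i).
  rewrite normrZ ger0_norm// powRM// ler_wpM2l ?powR_ge0//.
  by rewrite ge0_ler_powR ?nnegrE ?(ltW p0) ?(ltW K0).
have rK0 : 0 <= r * K by rewrite mulr_ge0 ?ltW.
have sp : s `^ p^-1 <= r * K.
  rewrite -[leRHS]powRr1// -(@mulfV _ p) ?gt_eqF// powRrM.
  by rewrite ge0_ler_powR ?nnegrE ?powR_ge0// invr_ge0 ltW.
apply: (@le_trans _ _ (C' * (r * K))).
  apply: (@le_trans _ _ (C' * s `^ p^-1)); last by rewrite ler_pM2l.
  by rewrite ler_wpM2r ?powR_ge0// le_max lexx.
by rewrite /r le_eqVlt; apply/orP; left; apply/eqP; field; lra.
Qed.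

Lemma mf_bounded_norm (R : realType) (X : normedModType R) (F : R -> set X) :
  mf_bounded F ->
  exists2 M : R, 0 < M & forall t a, `[0, 1]%classic t -> F t a -> `|a| <= M.
Proof.
rewrite /mf_bounded => Fb.
have FM t a : `[0, 1]%classic t -> F t a -> (`|a|%:E <= mf_sup_norm F)%E.
  by move=> t01 Fta; apply: ereal_sup_ubound; exists a => //; exists t.
case E : (mf_sup_norm F) Fb FM => [r| |] // _ FM.
(* The bound is made strictly positive because it will serve as the constant [K] above. *)
- exists (`|r| + 1); first by rewrite ltr_wpDl.
  move=> t a t01 /(FM _ _ t01); rewrite lee_fin => /le_trans; apply.
  by rewrite (le_trans (ler_norm _))// lerDl.
(* A supremum equal to [-oo] leaves no value to bound. *)
- by exists 1 => // t a t01 /(FM _ _ t01).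
Qed.

Lemma riemann_sum_midpoint (R : realType) (X : normedModType R)
    (F : R -> set X) (e : R) : B_convex X -> mf_bounded F -> 0 < e ->
  exists2 d : R, 0 < d & forall P : tagged_partition R, tp_mesh P < d ->
    forall u v, riemann_sum F P u -> riemann_sum F P v ->
    exists2 z, riemann_sum F P z & `|2^-1 *: (u + v) - z| <= e.
Proof.
move=> hX /mf_bounded_norm[M M0 FM] e0.
have [|d d0 dP] := @B_convex_small_signs R X (M + M) e hX _ e0.
  by rewrite addr_gt0.
exists d => // P /dP {}dP u v /riemann_sumP[x Fx ->] /riemann_sumP[y Fy ->].
have [|a ha] := dP (fun i => x i - y i).
  move=> i; rewrite (le_trans (ler_normB _ _))// lerD//.
  - exact: FM (tp_tag01 i) (Fx i).
  - exact: FM (tp_tag01 i) (Fy i).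
(* The sign at [i] is [(-1) ^+ a i]: [false] keeps [x i] and [true] keeps [y i], so [z] differs from
   the midpoint by half the signed sum. *)
exists (\sum_i tp_length i *: (if a i then y i else x i)).
  apply/riemann_sumP; exists (fun i => if a i then y i else x i) => // i; by case: (a i).
rewrite -big_split/= scaler_sumr -sumrB.
rewrite (_ : \sum_(i < _) _ =
  - (2^-1 *: signed_sum (fun i => tp_length i *: (x i - y i)) a)).
  rewrite normrN normrZ ger0_norm ?invr_ge0// (le_trans _ ha)//.
  by rewrite ler_piMl// invf_le1// ler1n.
rewrite /signed_sum scaler_sumr -sumrN; apply: eq_bigr => i _.
have midl (z t : X) : 2^-1 *: (z + t) - z = - (2^-1 *: (z - t)).
  have zE : z = 2^-1 *: (z + z).
    by rewrite scalerDr -scalerDl (_ : _ + _ = 1 :> R) ?scale1r//; field.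
  rewrite [X in _ - X = _]zE -scalerBr opprD addrACA subrr add0r.
  by rewrite -scalerN opprB.
rewrite scalerBr; case: (a i); last by rewrite expr0 scale1r midl.
by rewrite expr1 scaleN1r opprB -midl [_ + tp_length i *: x i]addrC.
Qed.

(** The strict inequality is what yields actual nearby points, since the infimum defining the
    distance to a set need not be attained. *)
Lemma hausdorff_dist_lt (R : realType) (X : normedModType R) (A B : set X)
    (e : R) : (hausdorff_dist A B < e%:E)%E ->
  (forall a, A a -> exists2 b, B b & `|a - b| < e) /\
  (forall b, B b -> exists2 a, A a & `|b - a| < e).
Proof.
have edist_approx (E E' : set X) :
    (ereal_sup [set edist_inf E' a | a in E] < e%:E)%E ->
    forall a, E a -> exists2 b, E' b & `|a - b| < e.
  move=> supe a Ea.
  have : (edist_inf E' a < e%:E)%E.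
    by apply: le_lt_trans supe; apply: ereal_sup_ubound; exists a.
  move=> /ereal_inf_lt[_ [b E'b <-]] /edist_lt_ball; rewrite -ball_normE/=.
  by exists b.
by rewrite /hausdorff_dist gt_max => /andP[/edist_approx ? /edist_approx].
Qed.

Theorem mainTheorem4 (R : realType) (X : completeNormedModType R)
    (hX : B_convex X) (F : R -> set X)
    (hF : multifunction01 F) (hFb : mf_bounded F) :
  forall A : set X, riemann_limits F A -> convex_set (A : set (convex_lmodType X)).
Proof.
move=> A [_ clA [P [Pmesh PA]]].
apply: closed_midpoint_convex => // a b Aa Ab.
apply: closed_approx clA _ => e e0.
(* Four errors are added: from [a] to [u], from [b] to [v], from the midpoint of [u] and [v] to [z],
   and from [z] to [c]. The factors [2^-1] on the first two are simply bounded by [1]. *)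
have e4 : 0 < e / 4 by rewrite divr_gt0.
have [d d0 dP] := riemann_sum_midpoint hX hFb e4.
have [k [kd kA]] : exists k, tp_mesh (P k) < d /\
    (hausdorff_dist (riemann_sum F (P k)) A < (e / 4)%:E)%E.
  have H1 : \forall k \near \oo, tp_mesh (P k) < d by apply: cvgr_lt Pmesh _ d0.
  have H2 : \forall k \near \oo,
      (hausdorff_dist (riemann_sum F (P k)) A < (e / 4)%:E)%E.
    apply: (PA [set x | (x < (e / 4)%:E)%E]).
    by apply: (open_nbhs_nbhs); split; [exact: open_ereal_lt_ereal|rewrite /= lte_fin].
  by have [k [? ?]] := filter_ex (filterI H1 H2); exists k.
have [SA AS] := hausdorff_dist_lt kA.
have [u Su au] := AS a Aa; have [v Sv bv] := AS b Ab.
have [z Sz uvz] := dP _ kd _ _ Su Sv; have [c Ac zc] := SA z Sz.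
exists c => //.
rewrite (_ : _ - c = 2^-1 *: (a - u) + 2^-1 *: (b - v)
  + (2^-1 *: (u + v) - z) + (z - c)); last first.
  by rewrite -scalerDr (addrACA a) -opprD scalerBr !subrKA.
have h x : `|2^-1 *: x : X| <= `|x|.
  by rewrite normrZ ger0_norm ?invr_ge0// ler_piMl// invf_le1// ler1n.
have := ler_normD (2^-1 *: (a - u) + 2^-1 *: (b - v) + (2^-1 *: (u + v) - z)) (z - c).
have := ler_normD (2^-1 *: (a - u) + 2^-1 *: (b - v)) (2^-1 *: (u + v) - z).
have := ler_normD (2^-1 *: (a - u)) (2^-1 *: (b - v)).
have := h (a - u); have := h (b - v).
lra.
Qed.
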